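(* Let $X$ be a locally convex topological vector space and let $K \subset X$ be a convex compact subset. Then there exists a function $f\colon K \to \mathbb{R}$ which is both lower semicontinuous and strictly convex if and only if $K$ imbeds linearly into a strictly convex dual Banach space $Z$ endowed with its weak$^*$ topology.
   Context: All vector spaces are real and locally convex spaces are Hausdorff. $f\colon K\to\mathbb{R}$ is strictly convex if $f(\lambda x+(1-\lambda)y)<\lambda f(x)+(1-\lambda)f(y)$ for all $x\neq y$ in $K$ and $\lambda\in(0,1)$. A strictly convex dual Banach space is a Banach space $Z=W^*$, equipped with the dual norm coming from a Banach space $W$ (so the norm is weak$^*$ lower semicontinuous), whose norm is strictly convex: $\|x\|=\|y\|=1$ and $x\ne y$ imply $\|x+y\|<2$. ''$K$ imbeds linearly into $(Z,w^* )$'' means that there is a linear map $T\colon \mathrm{span}(K)\to Z$ whose restriction to $K$ is a homeomorphism from $K$ (with the topology of $X$) onto $T(K)$ (with the weak$^*$ topology). *)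

(* Defs.v *)
From HB Require Import structures.
From mathcomp Require Import all_boot all_order all_algebra.
From mathcomp Require Import all_classical all_reals all_analysis.

Set Implicit Arguments.
Unset Strict Implicit.
Unset Printing Implicit Defensive.

Import Order.TTheory GRing.Theory Num.Theory.
Import numFieldNormedType.Exports.

Local Open Scope classical_set_scope.
Local Open Scope ring_scope.

(* A real function on a subset [K] of [X] is represented by a total function
   [X -> R] whose values outside [K] are irrelevant.  In the topology of
   [subspace K] the points outside [K] are isolated, so that lower
   semicontinuity constrains only the restriction of [f] to [K], with the
   topology induced by [X]. *)
Definition lower_semicontinuous_on (R : realType) (X : topologicalType)
    (K : set X) (f : X -> R) :=
  lower_semicontinuous (fun x : subspace K => (f x)%:E).

Definition strictly_convex_on (R : realType) (X : lmodType R)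
    (K : set X) (f : X -> R) :=
  forall (x y : X) (t : R), K x -> K y -> x <> y -> 0 < t < 1 ->
    f (t *: x + (1 - t) *: y) < t * f x + (1 - t) * f y.

Section dual_space.
Context {R : realType} (W : normedModType R).

Definition is_dual : {pred W -> R^o} :=
  fun phi => `[< linear phi /\ continuous phi >].

Record dual := Dual { dual_fun :> W -> R^o ; dual_funP : dual_fun \in is_dual }.

HB.instance Definition _ := [isSub for dual_fun].
HB.instance Definition _ := [Choice of dual by <:].

Lemma is_dual_submod : submod_closed is_dual.
Proof.
split.
  by apply/asboolP; split=> [a u v|x]; [rewrite scaler0 addr0|exact: cvg_cst].
move=> a f g /asboolP[lf cf] /asboolP[lg cg]; apply/asboolP; split.
  move=> b u v; rewrite !fctE lf lg !scalerDr !scalerA [b * a]mulrC.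
  by rewrite addrACA.
move=> x; apply: cvgD; last exact: cg.
by apply: cvgZr; exact: cf.
Qed.

HB.instance Definition _ :=
  GRing.isSubmodClosed.Build R (W -> R^o) is_dual is_dual_submod.
HB.instance Definition _ := [SubChoice_isSubLmodule of dual by <:].

Implicit Types phi psi : dual.

Lemma dual_linear phi : linear phi.
Proof. by have /asboolP[] := dual_funP phi. Qed.

Lemma dual_continuous phi : continuous phi.
Proof. by have /asboolP[] := dual_funP phi. Qed.

HB.instance Definition _ phi :=
  GRing.isLinear.Build R W R^o *:%R (dual_fun phi) (dual_linear phi).

Lemma dualD phi psi w : (phi + psi) w = phi w + psi w.
Proof. by []. Qed.

Lemma dualZ a phi w : (a *: phi) w = a * phi w.
Proof. by []. Qed.

Definition dual_norm phi : R := sup [set `|phi w| | w in [set w : W | `|w| <= 1]].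

Lemma dual_norm_has_sup phi :
  has_sup [set `|phi w| | w in [set w : W | `|w| <= 1]].
Proof.
split; first by exists `|phi 0|, 0 => //=; rewrite normr0.
have /bounded_funP/(_ 1)[M hM] : bounded_near phi (nbhs (0 : W)).
  exact/linear_bounded_continuous/dual_continuous.
by exists M => _ [w /= w1 <-]; exact: hM.
Qed.

Lemma dual_norm_ub phi w : `|w| <= 1 -> `|phi w| <= dual_norm phi.
Proof.
move=> w1; apply: sup_upper_bound; first exact: dual_norm_has_sup.
by exists w.
Qed.

Lemma dual_norm_le phi M :
  (forall w, `|w| <= 1 -> `|phi w| <= M) -> dual_norm phi <= M.
Proof.
move=> h; apply: ge_sup; first by case: (dual_norm_has_sup phi).
by move=> _ [w /= w1 <-]; exact: h.
Qed.

Lemma dual_norm_ge0 phi : 0 <= dual_norm phi.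
Proof.
by apply: (@le_trans _ _ `|phi 0|) => //; apply: dual_norm_ub; rewrite normr0.
Qed.

Lemma dual_normD phi psi : dual_norm (phi + psi) <= dual_norm phi + dual_norm psi.
Proof.
apply: dual_norm_le => w w1; rewrite dualD.
by rewrite (le_trans (ler_normD _ _))// lerD// dual_norm_ub.
Qed.

Lemma dual_normZ_le (a : R) phi : dual_norm (a *: phi) <= `|a| * dual_norm phi.
Proof.
by apply: dual_norm_le => w w1; rewrite dualZ normrM ler_wpM2l// dual_norm_ub.
Qed.

Lemma dual_normZ (a : R) phi : dual_norm (a *: phi) = `|a| * dual_norm phi.
Proof.
apply/le_anti; rewrite dual_normZ_le/=.
have [->|a0] := eqVneq a 0; first by rewrite normr0 mul0r dual_norm_ge0.
rewrite -ler_pdivlMl ?normr_gt0// -normfV.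
by apply: le_trans (dual_normZ_le _ _); rewrite scalerA mulVf// scale1r.
Qed.

Lemma dual_norm0_eq0 phi : dual_norm phi = 0 -> phi = 0.
Proof.
move=> h; apply/val_inj/funext => w /=.
have [->|w0] := eqVneq w 0; first by rewrite linear0.
have nw0 : `|w| != 0 by rewrite normr_eq0.
have : `|phi (`|w|^-1 *: w)| <= 0.
  by rewrite -h dual_norm_ub// normrZ normfV normr_id mulVf.
by rewrite normr_le0 linearZ/= scaler_eq0 invr_eq0 (negbTE nw0) => /eqP.
Qed.

HB.instance Definition _ :=
  Lmodule_isNormed.Build R dual dual_normD dual_normZ dual_norm0_eq0.

(* [dual] carries the topology of the dual norm; [weak_star] is the same space
   with the topology of pointwise convergence on [W]. *)
Definition weak_star :=
  initial_topology (dual_fun : dual -> {ptws W -> R^o}).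

HB.instance Definition _ := Topological.on weak_star.

End dual_space.

Definition strictly_convex_norm (R : realType) (Z : normedModType R) :=
  forall x y : Z, `|x| = 1 -> `|y| = 1 -> x <> y -> `|x + y| < 2.

Definition linear_span (R : realType) (X : lmodType R) (K : set X) : set X :=
  [set x | exists (n : nat) (c : 'I_n -> R) (v : 'I_n -> X),
    (forall i, K (v i)) /\ x = \sum_(i < n) c i *: v i].

Definition linear_on (R : realType) (X Z : lmodType R) (V : set X)
    (T : X -> Z) :=
  forall (a : R) (x y : X), V x -> V y -> T (a *: x + y) = a *: T x + T y.

(* [T] restricts to a homeomorphism from [K] onto [T @` K]. *)
Definition homeomorphism_on (X Y : topologicalType) (K : set X) (T : X -> Y) :=
  {within K, continuous T} /\
  exists g : Y -> X,
    {in K, cancel T g} /\ {within T @` K, continuous g}.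

(* [T] is only meaningful on the linear span of [K], where it is linear. *)
Definition embeds_linearly_weak_star (R : realType) (X : tvsType R)
    (K : set X) (W : normedModType R) :=
  exists T : X -> dual W,
    linear_on (linear_span K) T /\
    homeomorphism_on K (T : X -> weak_star W).

(* Main.v *)
(** The function [x |-> `|T x| ^+ 2] settles one direction, the dual norm
    being weak* lower semicontinuous.  Conversely, after restricting [f] to a
    homothetic copy of [K] inside [K] on which it is bounded, and rescaling, we
    may assume [0 <= f <= 1].  On the cone over [K] the cost
    [a x |-> a ^+ 2 + a * f x] is then strictly convex, so the differences
    [c - d] of cone points of total cost at most [1] form a compact symmetric
    convex set [B] such that the midpoint of two distinct points of [B] can be
    dilated by a factor [1 + e] within [B].  Let [W] be the Banach space of the
    linear functionals on the span of [B] that are continuous on [B], normed by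
    their supremum on [B].  Every element of the unit ball of the dual of [W] is
    the evaluation at a point of [B], so the dual norm is strictly convex, and
    evaluation embeds [K] because continuous linear functionals separate its
    points. *)

From HB Require Import structures.
Require Import Defs.
From mathcomp Require Import all_boot all_order all_algebra.
From mathcomp Require Import all_classical all_reals all_analysis.
From mathcomp Require Import ring lra.

Set Implicit Arguments.
Unset Strict Implicit.
Unset Printing Implicit Defensive.

Import Order.TTheory GRing.Theory Num.Theory.
Import numFieldNormedType.Exports.

Local Open Scope classical_set_scope.
Local Open Scope ring_scope.

(** * Hahn-Banach *)

Section hahn_banach.
Context {R : realType} {V : lmodType R}.
Implicit Types (p q : V -> R) (x y : V).

Lemma le_infD (A B : set R) (c : R) : A !=set0 -> B !=set0 ->
  (forall a b, A a -> B b -> c <= a + b) -> c <= inf A + inf B.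
Proof.
move=> A0 B0 h; rewrite -lerBlDr; apply: lb_le_inf => // a Aa.
rewrite lerBlDr -lerBlDl; apply: lb_le_inf => // b Bb.
by rewrite lerBlDl; exact: h.
Qed.

(** Homogeneity is stated as an inequality for positive factors; applying it to the inverse factor
    as well turns it into an equality. *)
Definition sublinear p :=
  (forall x y, p (x + y) <= p x + p y) /\
  (forall a x, 0 < a -> p (a *: x) <= a * p x).

Lemma sublinearZ p a x : sublinear p -> 0 <= a -> p (a *: x) = a * p x.
Proof.
move=> [_ pZ].
have pos b y : 0 < b -> p (b *: y) = b * p y.
  move=> b0; apply/le_anti; rewrite pZ//=.
  by rewrite -ler_pdivlMl// (le_trans _ (pZ _ _ _)) ?invr_gt0// scalerK ?gt_eqF.
rewrite le_eqVlt => /predU1P[<-|]; last exact: pos.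
(* For [a = 0]: [p 0 = p (2 *: 0) = 2 * p 0] forces [p 0 = 0]. *)
have := pos 2 0; rewrite scaler0 scale0r mul0r => h.
by have := h ltac:(by []); lra.
Qed.

Lemma sublinear0 p : sublinear p -> p 0 = 0.
Proof.
by move=> hp; have := @sublinearZ p 0 0 hp (lexx _); rewrite scale0r mul0r.
Qed.

Lemma sublinear_oppr_le p x : sublinear p -> - p (- x) <= p x.
Proof.
by move=> hp; have := hp.1 x (- x); rewrite subrr sublinear0//; lra.
Qed.

(* The largest sublinear functional below [p] whose value at [- y] is at most
   [- p y]; a minimal [p] must coincide with it, which makes [p] linear. *)
Definition slide p y x : R :=
  inf [set p (x + t *: y) - t * p y | t in [set t | 0 <= t]].

Section slide.
Variables (p : V -> R) (y : V).
Hypothesis hp : sublinear p.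

Let slide_nonempty x :
  [set p (x + t *: y) - t * p y | t in [set t | 0 <= t]] !=set0.
Proof. by exists (p (x + 0 *: y) - 0 * p y), 0 => /=. Qed.

Lemma slide_le_at x t : 0 <= t -> slide p y x <= p (x + t *: y) - t * p y.
Proof.
move=> t0; apply: ge_inf; last by exists t.
(* The infimum is finite because [s * p y = p (s *: y) <= p (x + s *: y) + p (- x)]. *)
exists (- p (- x)) => _ [s /= s0 <-].
have := hp.1 (x + s *: y) (- x).
by rewrite addrAC subrr add0r sublinearZ//; lra.
Qed.

Lemma slide_le x : slide p y x <= p x.
Proof.
by have := slide_le_at x (lexx 0); rewrite scale0r addr0 mul0r subr0.
Qed.

Lemma slide_opp : slide p y (- y) <= - p y.
Proof.
have := slide_le_at (- y) ler01.
by rewrite scale1r addNr sublinear0// sub0r mul1r.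
Qed.

Lemma slide_sublinear : sublinear (slide p y).
Proof.
split=> [x x'|a x a0].
- apply: le_infD => // _ _ [t /= t0 <-] [s /= s0 <-].
  apply: (le_trans (slide_le_at _ (addr_ge0 t0 s0))).
  have := hp.1 (x + t *: y) (x' + s *: y).
  by rewrite addrACA -scalerDl; lra.
- rewrite -ler_pdivrMl//; apply: lb_le_inf => // _ [t /= t0 <-].
  rewrite ler_pdivrMl//.
  apply: (le_trans (slide_le_at _ (mulr_ge0 (ltW a0) t0))).
  by rewrite -scalerA -scalerDr sublinearZ ?(ltW a0)// mulrBr mulrA.
Qed.

End slide.

(** Zorn's lemma for the reversed pointwise order. A nonempty chain is bounded by its pointwise
    infimum, which is finite since every member satisfies [- p (- x) <= - q (- x) <= q x]. *)
Lemma minimal_sublinear p : sublinear p ->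
  exists q, [/\ sublinear q, forall x, q x <= p x &
    forall q', sublinear q' -> (forall x, q' x <= q x) -> q' = q].
Proof.
move=> hp; pose T := {q : V -> R | sublinear q /\ forall x, q x <= p x}.
pose r (q q' : T) := `[< forall x, sval q' x <= sval q x >].
have [|q1 q2 q3 /asboolP h12 /asboolP h23||A totA|[q [hq qp]] qmin] :=
  @Zorn T r.
- by move=> q; apply/asboolP.
- by apply/asboolP => x; exact: le_trans (h12 x).
- move=> [q1 h1] [q2 h2] /asboolP/= h12 /asboolP/= h21.
  apply: eq_exist => /=; apply/funext => x; apply/le_anti.
  by rewrite h12 h21.
- have [->|/set0P[q0 Aq0]] := eqVneq A set0.
    by exists (exist _ p (conj hp (fun x => lexx _))).
  pose m x := inf [set sval q x | q in A].
  have A0 x : [set sval q x | q in A] !=set0 by exists (sval q0 x), q0.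
  have mle (q : T) x : A q -> m x <= sval q x.
    move=> Aq; apply: ge_inf; last by exists q.
    exists (- p (- x)) => _ [[q' [hq' q'p]] _ <-] /=.
    by apply: le_trans (sublinear_oppr_le _ hq'); rewrite lerN2.
  have hm : sublinear m.
    split=> [x y|a x a0].
      apply: le_infD => // _ _ [q Aq <-] [q' Aq' <-].
      (* Members of a chain are comparable, so the smaller of [q] and [q'] serves at both points at
         once. *)
      have [q2 Aq2 [h1 h2]] : exists2 q2, A q2 &
          sval q2 x <= sval q x /\ sval q2 y <= sval q' y.
        have [/asboolP h|/asboolP h] := totA _ _ Aq Aq'.
          by exists q'.
        by exists q.
      apply: le_trans (mle _ _ Aq2) _.
      by apply: le_trans ((svalP q2).1.1 _ _) _; exact: lerD.
    rewrite -ler_pdivrMl//; apply: lb_le_inf => // _ [q Aq <-].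
    rewrite ler_pdivrMl//; apply: le_trans (mle _ _ Aq) _.
    exact: (svalP q).1.2.
  have mp x : m x <= p x by apply: le_trans (mle _ x Aq0) ((svalP q0).2 x).
  exists (exist _ m (conj hm mp)) => q Aq.
  by apply/asboolP => x /=; exact: mle.
- exists q; split=> // q' hq' q'q.
  have q'p x : q' x <= p x by exact: le_trans (qp x).
  have := qmin (exist _ q' (conj hq' q'p)).
  by move=> /(_ (asboolT q'q)) /(congr1 sval).
Qed.

(** Take [L] minimal below [slide p x0]. Minimality gives [slide L y = L] for every [y], so
    [L (- y) <= - L y]; thus [L] is odd, and an odd sublinear functional is linear. Starting from
    [slide p x0] forces [L (- x0) <= - p x0], hence equality at [x0]. *)
Lemma hahn_banach p x0 : sublinear p ->
  exists L : V -> R, [/\ scalar L, forall x, L x <= p x & L x0 = p x0].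
Proof.
move=> hp.
have [L [hL Lp Lmin]] := minimal_sublinear (slide_sublinear x0 hp).
have LN y : L (- y) = - L y.
  apply/le_anti; apply/andP; split.
    rewrite -[leLHS](_ : slide L y (- y) = _) ?slide_opp//.
    by rewrite (Lmin (slide L y))//;
      [exact: slide_sublinear|move=> x; exact: slide_le].
  by have := sublinear_oppr_le (- y) hL; rewrite opprK.
have LD x y : L (x + y) = L x + L y.
  apply/le_anti; rewrite hL.1/=.
  by have := hL.1 (x + y) (- y); rewrite addrK LN; lra.
have LZ a x : L (a *: x) = a * L x.
  have [a0|a0] := leP 0 a; first exact: sublinearZ.
  rewrite -[a in LHS]opprK scaleNr LN sublinearZ ?oppr_ge0 ?ltW//.
  by rewrite mulNr opprK.
exists L; split.
- by move=> a x y; rewrite LD LZ.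
- by move=> x; apply: le_trans (Lp x) (slide_le _ hp _).
- apply/le_anti; apply/andP; split.
    exact: le_trans (Lp x0) (slide_le _ hp _).
  by have := le_trans (Lp (- x0)) (slide_opp x0 hp); rewrite LN lerN2.
Qed.

End hahn_banach.

(** * Minkowski gauges and separation of points by continuous functionals *)

Lemma continuous_pair (T U V : topologicalType) (f : T -> U) (g : T -> V) x :
  {for x, continuous f} -> {for x, continuous g} ->
  {for x, continuous (fun y => (f y, g y))}.
Proof.
move=> cf cg.
exact: (@cvg_pair T U V (nbhs x) (nbhs (f x)) (nbhs (g x)) _ _ _ f g).
Qed.

Section gauge.
Context {R : realType} {X : tvsType R}.

Lemma continuousZ_tvs (S : topologicalType) (a : S -> R^o) (f : S -> X) s :
  {for s, continuous a} -> {for s, continuous f} ->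
  {for s, continuous (fun r => a r *: f r)}.
Proof.
move=> ca cf.
apply: (@continuous_comp _ _ _ (fun r => (a r, f r)) (fun z => z.1 *: z.2)).
  exact: continuous_pair.
exact: scale_continuous.
Qed.

Lemma continuousD_tvs (S : topologicalType) (f g : S -> X) (s : S) :
  {for s, continuous f} -> {for s, continuous g} ->
  {for s, continuous (fun r => f r + g r)}.
Proof.
move=> cf cg.
apply: (@continuous_comp _ _ _ (fun r => (f r, g r)) (fun z => z.1 + z.2)).
  exact: continuous_pair.
exact: add_continuous.
Qed.

Lemma continuous_homothety (c : X) (l : R) :
  continuous (fun x : X => c + l *: x).
Proof.
move=> x; suff : {for x, continuous (fun y : X => c + l *: y)} by [].
apply: continuousD_tvs; first exact: cvg_cst.
by apply: continuousZ_tvs; [exact: cvg_cst|exact: cvg_id].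
Qed.

Definition gauge (U : set X) (x : X) : R :=
  inf [set t | 0 < t /\ U (t^-1 *: x)].

Variable U : set X.
Hypothesis U0 : nbhs 0 U.
Hypothesis convU : forall (x y : X) (t : R), U x -> U y -> 0 < t < 1 ->
  U (t *: x + (1 - t) *: y).

Let gauge_nonempty x : [set t | 0 < t /\ U (t^-1 *: x)] !=set0.
Proof.
have : (fun t : R => t *: x) @ (0 : R) --> (0 : X).
  rewrite -[X in _ --> X](scale0r x).
  by apply: (@continuousZ_tvs R^o id (cst x)); [exact: cvg_id|exact: cvg_cst].
move=> /(_ _ U0) [e /= e0 he].
exists (e / 2)^-1; split; first by rewrite invr_gt0 divr_gt0.
rewrite invrK; apply: he; rewrite /= sub0r normrN gtr0_norm ?divr_gt0//.
by rewrite ltr_pdivrMr// ltr_pMr// ltr1n.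
Qed.

Let gauge_lb x : has_lbound [set t | 0 < t /\ U (t^-1 *: x)].
Proof. by exists 0 => t [/ltW]. Qed.

Let gauge_le x t : 0 < t -> U (t^-1 *: x) -> gauge U x <= t.
Proof. by move=> t0 h; apply: ge_inf. Qed.

Lemma gauge_sublinear : sublinear (gauge U).
Proof.
split=> [x y|a x a0].
- apply: le_infD; [exact: gauge_nonempty|exact: gauge_nonempty|].
  move=> s t [s0 hs] [t0 ht].
  apply: gauge_le; first exact: addr_gt0.
  have st0 : 0 < s + t by exact: addr_gt0.
  rewrite (_ : _ *: _ = (s / (s + t)) *: (s^-1 *: x)
      + (1 - s / (s + t)) *: (t^-1 *: y)).
    apply: convU => //; rewrite divr_gt0//= ltr_pdivrMr// mul1r; lra.
  have sn : s != 0 by rewrite gt_eqF.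
  have tn : t != 0 by rewrite gt_eqF.
  have stn : s + t != 0 by rewrite gt_eqF.
  rewrite !scalerA scalerDr.
  by congr (_ *: _ + _ *: _); field; rewrite ?sn ?tn ?stn.
- rewrite -ler_pdivrMl//; apply: lb_le_inf; first exact: gauge_nonempty.
  move=> t [t0 ht].
  rewrite ler_pdivrMl//; apply: gauge_le; first exact: mulr_gt0.
  rewrite scalerA (_ : _ * a = t^-1)//.
  by field; rewrite !gt_eqF.
Qed.

Lemma gauge_le1 x : U x -> gauge U x <= 1.
Proof. by move=> Ux; apply: gauge_le => //; rewrite invr1 scale1r. Qed.

Lemma gauge_ge1 x : ~ U x -> 1 <= gauge U x.
Proof.
move=> nUx; apply: lb_le_inf; first exact: gauge_nonempty.
move=> t [t0 Ut]; rewrite leNgt; apply/negP => t1.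
apply: nUx; rewrite -[x](@scalerKV _ _ t) ?gt_eqF// -[X in U X]addr0.
rewrite -(scaler0 _ (1 - t)); apply: convU => //; last by rewrite t0.
exact: nbhs_singleton.
Qed.

End gauge.

(** For [y] near [x] both points [e^-1 *: (y - x)] and [- e^-1 *: (y - x)] lie in [U], and the
    one-sided bound at the two of them gives [|L x - L y| <= e]. *)
Lemma scalar_continuous (R : realType) (X : tvsType R) (U : set X)
    (L : X -> R) :
  nbhs 0 U -> scalar L -> (forall x, U x -> L x <= 1) -> continuous L.
Proof.
move=> U0 linL LU x.
have LB y z : L (y - z) = L y - L z.
  by rewrite addrC -scaleN1r linL mulN1r addrC.
have LZ a y : L (a *: y) = a * L y.
  have L0 : L 0 = 0 by have := LB 0 0; rewrite !subrr.
  by rewrite -[a *: y]addr0 linL L0 addr0.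
apply/cvgrPdist_le => e e0.
have near_x (s : R) : \forall y \near x, U (s *: (y - x)).
  have : {for x, continuous (fun y : X => s *: (y - x))}.
    apply: continuousZ_tvs; first exact: cvg_cst.
    by apply: continuousD_tvs; [exact: cvg_id|exact: cvg_cst].
  by apply; rewrite subrr scaler0.
have [h1 h2] := (near_x e^-1, near_x (- e^-1)).
near=> y.
have /LU : U (e^-1 *: (y - x)) by near: y.
have /LU : U (- e^-1 *: (y - x)) by near: y.
rewrite !LZ !LB mulNr => a1 a2.
rewrite -[e]mulr1 -ler_pdivrMl// -[X in X * _]gtr0_norm ?invr_gt0//.
rewrite -normrM ler_norml.
by rewrite mulrBr; move: a1 a2; rewrite mulrBr; lra.
Unshelve. all: by end_near. Qed.

Lemma tvs_convexP (R : realType) (X : tvsType R) (K : set X) :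
  convex_set (K : set (convex_lmodType X)) ->
  forall (x y : X) (t : R), K x -> K y -> 0 <= t <= 1 ->
    K (t *: x + (1 - t) *: y).
Proof.
move=> convK x y t Kx Ky t01.
have /andP[t0 t1] := t01.
have := convK x y (Itv01 t0 t1) (mem_set Kx) (mem_set Ky).
by rewrite inE.
Qed.

(** Hahn-Banach for the gauge of a convex neighbourhood [U] of [0] that misses [x - y]: the
    functional takes at [x - y] the value of the gauge, which is at least [1], and it is continuous
    because the gauge is at most [1] on [U]. *)
Lemma continuous_scalar_separates (R : realType) (X : tvsType R) (x y : X) :
  hausdorff_space X -> x != y ->
  exists L : X -> R, [/\ scalar L, continuous L & L x != L y].
Proof.
move=> hX xy.
have [U [U0 convU nU]] : exists U : set X, [/\ nbhs 0 U,
    (forall (x y : X) (t : R), U x -> U y -> 0 < t < 1 ->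
      U (t *: x + (1 - t) *: y)) & ~ U (x - y)].
  have [B convB [openB basB]] := @locally_convex R X.
  have : accessible_space X by exact: hausdorff_accessible.
  have /[swap]/[apply] : (0 : X) != x - y by rewrite eq_sym subr_eq0.
  move=> [V [openV /set_mem V0 nV]].
  have [U [BU U0] UV] := basB 0 V (open_nbhs_nbhs (conj openV V0)).
  exists U; split.
  - by apply: open_nbhs_nbhs; split => //; apply: openB.
  - move=> u v t Uu Uv /andP[/ltW t0 /ltW t1].
    have := convB U (mem_set BU) u v (Itv01 t0 t1) (mem_set Uu) (mem_set Uv).
    by rewrite inE.
  - by move/UV; move: nV; rewrite inE.
have [L [linL Lle Lxy]] := hahn_banach (x - y) (gauge_sublinear U0 convU).
exists L; split => //.
  by apply: (scalar_continuous U0) => // z Uz; exact: le_trans (gauge_le1 _).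
rewrite -subr_eq0.
have <- : L (x - y) = L x - L y by rewrite addrC -scaleN1r linL mulN1r addrC.
by rewrite Lxy gt_eqF// (lt_le_trans ltr01)// gauge_ge1.
Qed.

(** * Functionals continuous on a set *)

Section linear_span.
Context {R : realType} {X : lmodType R}.
Implicit Types (K : set X) (x y : X).

Lemma linear_span_sum K n (c : 'I_n -> R) (v : 'I_n -> X) :
  (forall i, K (v i)) -> linear_span K (\sum_(i < n) c i *: v i).
Proof. by move=> Kv; exists n, c, v. Qed.

Lemma linear_span0 K : linear_span K 0.
Proof.
by exists 0%N, (fun=> 0), (fun=> 0); rewrite big_ord0; split => // -[].
Qed.

Lemma sub_linear_span K : K `<=` linear_span K.
Proof.
by move=> x Kx; exists 1%N, (fun=> 1), (fun=> x); rewrite big_ord1 scale1r.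
Qed.

Lemma linear_spanP K a x y :
  linear_span K x -> linear_span K y -> linear_span K (a *: x + y).
Proof.
move=> [n [c [v [Kv ->]]]] [m [d [u [Ku ->]]]].
exists (n + m)%N.
exists (fun i =>
  match fintype.split i with inl j => a * c j | inr k => d k end).
exists (fun i => match fintype.split i with inl j => v j | inr k => u k end).
split; first by move=> i; case: fintype.split.
rewrite big_split_ord/= scaler_sumr; congr (_ + _); apply: eq_bigr => i _.
  by rewrite -[lshift m i]/(unsplit (inl i)) unsplitK scalerA.
by rewrite -[rshift n i]/(unsplit (inr i)) unsplitK.
Qed.

Lemma linear_span_sub K K' :
  K `<=` linear_span K' -> linear_span K `<=` linear_span K'.
Proof.
move=> KK' _ [n [c [v [Kv ->]]]]; elim: n => [|n ih] in c v Kv *.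
  by rewrite big_ord0; exact: linear_span0.
rewrite big_ord_recr/= addrC; apply: linear_spanP; first exact: KK'.
by apply: ih => i; exact: Kv.
Qed.

Section linear_on.
Context {Z : lmodType R} (K : set X) (T : X -> Z).
Hypothesis linT : linear_on (linear_span K) T.

Lemma linear_on0 : T 0 = 0.
Proof.
have := linT (-1) (linear_span0 K) (linear_span0 K).
by rewrite scaler0 addr0 scaleN1r addNr.
Qed.

Lemma linear_on_sum n (c : 'I_n -> R) (v : 'I_n -> X) : (forall i, K (v i)) ->
  T (\sum_(i < n) c i *: v i) = \sum_(i < n) c i *: T (v i).
Proof.
elim: n => [|n ih] in c v *; first by rewrite !big_ord0 linear_on0.
move=> Kv; rewrite !big_ord_recr/= addrC linT ?ih//; first by rewrite addrC.
  exact: sub_linear_span.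
exact: linear_span_sum.
Qed.

Lemma linear_on_comb a b x y : linear_span K x -> linear_span K y ->
  T (a *: x + b *: y) = a *: T x + b *: T y.
Proof.
move=> Kx Ky; have K0 := linear_span0 K.
rewrite linT//; last by rewrite -[b *: y]addr0; exact: linear_spanP.
by rewrite -[b *: y]addr0 linT// linear_on0 addr0.
Qed.

End linear_on.
End linear_span.

(** The three-epsilon estimate for continuity of a uniform limit: [a], [b] are values of the
    approximant and [c], [d] those of the limit. *)
Lemma dist_thirds (R : realFieldType) (a b c d e : R) :
  `|a - c| <= e / 3 -> `|b - d| <= e / 3 -> `|a - b| <= e / 3 -> `|c - d| <= e.
Proof. by rewrite !ler_norml; lra. Qed.

(** * The Banach space of linear functionals continuous on a set *)

Section bfun.
Context {R : realType} {X : tvsType R} (B : set X).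

(* Functionals vanish off the span, where they are irrelevant, so that they are
   determined by their values on [B]. *)
Definition is_bfun : {pred X -> R^o} := fun w =>
  `[< [/\ linear_on (linear_span B) (w : X -> R^o),
          {within B, continuous w},
          exists M, forall x, B x -> `|w x| <= M &
          forall x, ~ linear_span B x -> w x = 0] >].

Record bfun := Bfun { bfun_fun :> X -> R^o ; bfun_funP : bfun_fun \in is_bfun }.

HB.instance Definition _ := [isSub for bfun_fun].
HB.instance Definition _ := [Choice of bfun by <:].

Lemma is_bfun_submod : submod_closed is_bfun.
Proof.
split.
  apply/asboolP; split => //.
  - by move=> a x y _ _; rewrite scaler0 addr0.
  - by move=> x; exact: cvg_cst.
  - by exists 0 => x _; rewrite normr0.
move=> a u v /asboolP[lu cu [M uM] u0] /asboolP[lv cv [N vN] v0].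
apply/asboolP; split.
- move=> b x y Bx By; rewrite !fctE lu// lv// !scalerDr !scalerA [b * a]mulrC.
  by rewrite addrACA.
- by move=> x; apply: cvgD; [apply: cvgZl_tmp; exact: cu|exact: cv].
- exists (`|a| * M + N) => x Bx; rewrite (le_trans (ler_normD _ _))//.
  by rewrite lerD ?vN// normrM ler_wpM2l ?uM.
- by move=> x Bx; rewrite !fctE u0// v0// scaler0 addr0.
Qed.

HB.instance Definition _ :=
  GRing.isSubmodClosed.Build R (X -> R^o) is_bfun is_bfun_submod.
HB.instance Definition _ := [SubChoice_isSubLmodule of bfun by <:].

Implicit Types u v w : bfun.

Lemma bfun_linear w : linear_on (linear_span B) w.
Proof. by have /asboolP[] := bfun_funP w. Qed.

Lemma bfun_sum w n (c : 'I_n -> R) (v : 'I_n -> X) : (forall i, B (v i)) ->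
  w (\sum_(i < n) c i *: v i) = \sum_(i < n) c i * w (v i).
Proof. by move=> Bv; rewrite (linear_on_sum (@bfun_linear w)). Qed.

Lemma bfun_comb w a b x y : linear_span B x -> linear_span B y ->
  w (a *: x + b *: y) = a * w x + b * w y.
Proof. exact: linear_on_comb (@bfun_linear w) _ _ _ _. Qed.

Lemma bfun_continuous w : {within B, continuous w}.
Proof. by have /asboolP[] := bfun_funP w. Qed.

Lemma bfun_out w x : ~ linear_span B x -> w x = 0.
Proof. by have /asboolP[_ _ _] := bfun_funP w; exact. Qed.

Lemma bfun0 w : w 0 = 0.
Proof. exact: linear_on0 (@bfun_linear w). Qed.

Lemma bfunB u v x : (u - v) x = u x - v x. Proof. by []. Qed.

Lemma bfunZ a w x : (a *: w) x = a * w x. Proof. by []. Qed.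

Lemma bfun_ext u v : (forall x, B x -> u x = v x) -> u = v.
Proof.
move=> uv; apply/val_inj/funext => x /=.
have [[n [c [y [By ->]]]]|nBx] := pselect (linear_span B x).
  rewrite !bfun_sum//.
  by apply: eq_bigr => i _; rewrite uv.
by rewrite !bfun_out.
Qed.

(* Adding [0] to [B] only serves to keep the set of values nonempty. *)
Definition bfun_norm w : R := sup [set `|w x| | x in B `|` [set 0]].

Lemma bfun_norm_has_sup w : has_sup [set `|w x| | x in B `|` [set 0]].
Proof.
split; first by exists `|w 0|, 0 => //; right.
have /asboolP[_ _ [M wM] _] := bfun_funP w.
exists `|M| => _ [x [Bx|->] <-]; last by rewrite bfun0 normr0.
exact: le_trans (wM _ Bx) (ler_norm M).
Qed.

Lemma bfun_norm_ub w x : B x -> `|w x| <= bfun_norm w.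
Proof.
move=> Bx; apply: sup_upper_bound; first exact: bfun_norm_has_sup.
by exists x => //; left.
Qed.

Lemma bfun_norm_ge0 w : 0 <= bfun_norm w.
Proof.
rewrite -(normr0 R) -(bfun0 w).
by apply: sup_upper_bound; [exact: bfun_norm_has_sup|exists 0 => //; right].
Qed.

Lemma bfun_norm_le w M :
  0 <= M -> (forall x, B x -> `|w x| <= M) -> bfun_norm w <= M.
Proof.
move=> M0 wM; apply: ge_sup; first by case: (bfun_norm_has_sup w).
by move=> _ [x [Bx|->] <-]; [exact: wM|rewrite bfun0 normr0].
Qed.

Lemma bfun_normD u v : bfun_norm (u + v) <= bfun_norm u + bfun_norm v.
Proof.
apply: bfun_norm_le => [|x Bx]; first by rewrite addr_ge0// bfun_norm_ge0.
by rewrite (le_trans (ler_normD _ _))// lerD// bfun_norm_ub.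
Qed.

Lemma bfun_normZ (a : R) w : bfun_norm (a *: w) = `|a| * bfun_norm w.
Proof.
have le b v : bfun_norm (b *: v) <= `|b| * bfun_norm v.
  apply: bfun_norm_le => [|x Bx]; first by rewrite mulr_ge0// bfun_norm_ge0.
  by rewrite bfunZ normrM ler_wpM2l// bfun_norm_ub.
apply/le_anti; rewrite le/=.
have [->|a0] := eqVneq a 0; first by rewrite normr0 mul0r bfun_norm_ge0.
rewrite -ler_pdivlMl ?normr_gt0// -normfV.
by apply: le_trans (le _ _); rewrite scalerA mulVf// scale1r.
Qed.

Lemma bfun_norm0_eq0 w : bfun_norm w = 0 -> w = 0.
Proof.
move=> w0; apply: bfun_ext => x Bx; apply/eqP.
by rewrite -normr_le0 -w0 bfun_norm_ub.
Qed.

HB.instance Definition _ :=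
  Lmodule_isNormed.Build R bfun bfun_normD bfun_normZ bfun_norm0_eq0.

Lemma ler_bfun_norm w x : B x -> `|w x| <= `|w|.
Proof. exact: bfun_norm_ub. Qed.

Lemma bfun_norm_leP w M : 0 <= M -> (forall x, B x -> `|w x| <= M) -> `|w| <= M.
Proof. exact: bfun_norm_le. Qed.

(** On the span, [M] is the sum of the absolute values of the coefficients of [x] over points of
    [B]; off the span every [w] vanishes. Thus each point of [X] gives an element of the dual, and
    evaluation is a total map. *)
Lemma bfun_eval_bounded x : exists M, forall w, `|w x| <= M * `|w|.
Proof.
have [[n [c [y [By ->]]]]|nBx] := pselect (linear_span B x); last first.
  by exists 0 => w; rewrite bfun_out// normr0 mul0r.
exists (\sum_(i < n) `|c i|) => w.
rewrite bfun_sum//.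
rewrite mulr_suml (le_trans (ler_norm_sum _ _ _))// ler_sum// => i _.
by rewrite normrM ler_wpM2l// ler_bfun_norm.
Qed.

Lemma bfun_eval_dual x : (fun w : bfun => w x : R^o) \in @is_dual R bfun.
Proof.
apply/asboolP; split=> [a u v //|].
have lin : linear (fun w : bfun => w x : R^o) by [].
have [M hM] := bfun_eval_bounded x.
pose f := HB.pack_for {linear bfun -> R^o} (fun w : bfun => w x : R^o)
  (GRing.isLinear.Build _ _ _ _ (fun w : bfun => w x : R^o) lin).
have : continuous f; last by [].
apply: bounded_linear_continuous.
apply/bounded_funP => r; exists (`|M| * r) => w wr.
rewrite [leLHS](_ : _ = `|w x|)// (le_trans (hM w))//.
by rewrite (le_trans (ler_wpM2r _ (ler_norm M)))// ler_wpM2l.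
Qed.

Definition bfun_eval x : dual bfun := Dual (bfun_eval_dual x).

(** The filter converges pointwise on [B], hence on the span by linearity, and trivially off it. The
    limit stays within [e] of [w0] on [B] as soon as [F] is eventually within [e] of [w0]; this
    uniformity makes the limit bounded and continuous on [B], and makes the convergence hold in
    norm. *)
Lemma bfun_complete (F : set_system bfun) : ProperFilter F -> cauchy F -> cvg F.
Proof.
move=> FF /cauchyP Fc.
have Fnorm e : 0 < e -> exists w0 : bfun, \forall w \near F, `|w0 - w| < e.
  by move=> e0; have [w0 h] := Fc e e0; exists w0; move: h; rewrite -ball_normE.
have cvg_at x : B x -> exists l : R^o, (fun w : bfun => w x) @ F --> l.
  move=> Bx; apply/cvg_ex; apply: R_complete; apply/cauchyP => e e0.
  have [w0 h] := Fnorm e e0; exists (w0 x).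
  have : \forall w \near F, ball (w0 x : R^o) e ((w : bfun) x).
    near=> w; rewrite -ball_normE /=.
    rewrite -[_ - _]/((w0 - w) x) (le_lt_trans (ler_bfun_norm _ Bx))//.
    by near: w.
  exact.
have cvgX x : exists l : R^o, (fun w : bfun => w x) @ F --> l.
  have [[n [c [y [By ->]]]]|nBx] := pselect (linear_span B x); last first.
    exists 0; rewrite (_ : (fun _ => _) = cst 0); first exact: cvg_cst.
    by apply/funext => w; exact: bfun_out.
  have /choice[l hl] i := cvg_at _ (By i).
  exists (\sum_(i < n) c i *: l i).
  rewrite (_ : (fun _ => _) = (fun w : bfun => \sum_(i < n) c i *: w (y i))).
    by apply: cvg_big => [|i _]; [exact: add_continuous|apply: cvgZl_tmp].
  by apply/funext => w; rewrite bfun_sum.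
have /choice[l hl] := cvgX.
have lB e w0 : (\forall w \near F, `|w0 - w| < e) ->
    forall x, B x -> `|w0 x - l x| <= e.
  move=> h x Bx; apply/ler_addgt0Pr => d d0.
  have /cvgrPdist_le/(_ d d0) lw := hl x.
  near F => w.
  have w0w : `|w0 x - w x| <= e.
    rewrite -[_ - _]/((w0 - w) x) (le_trans (ler_bfun_norm _ Bx))//.
    by apply/ltW; near: w.
  have : `|l x - w x| <= d by near: w.
  by move: w0w; rewrite !ler_norml; lra.
have lP : (l : X -> R^o) \in is_bfun.
  apply/asboolP; split.
  - move=> a x y Bx By.
    apply: (@cvg_unique _ (@norm_hausdorff _ _) _ _ _ _ (hl _)).
    rewrite (_ : (fun _ => _) = (fun w : bfun => a *: w x + w y)).
      by apply: cvgD; [apply: cvgZl_tmp|]; exact: hl.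
    by apply/funext => w; exact: bfun_linear.
  - apply/subspace_continuousP => x Bx; apply/cvgrPdist_le => e e0.
    have e3 : 0 < e / 3 by rewrite divr_gt0.
    have [w0 /lB h] := Fnorm _ e3.
    have /subspace_continuousP/(_ x Bx)/cvgrPdist_le/(_ _ e3) cw0 :=
      @bfun_continuous w0.
    near=> y.
    have By : B y by near: y; exact: withinT.
    have : `|w0 x - w0 y| <= e / 3 by near: y.
    exact: dist_thirds (h _ Bx) (h _ By).
  - have [w0 /lB h] := Fnorm _ ltr01.
    exists (1 + `|w0|) => x Bx; rewrite -[l x](subrK (w0 x)).
    rewrite (le_trans (ler_normD _ _))// lerD ?ler_bfun_norm// distrC.
    exact: h.
  - move=> x nBx; apply: (@cvg_unique _ (@norm_hausdorff _ _) _ _ _ _ (hl _)).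
    rewrite (_ : (fun _ => _) = cst 0); first exact: cvg_cst.
    by apply/funext => w; exact: bfun_out.
apply/cvg_ex; exists (Bfun lP); apply/cvgrPdist_le => e e0.
have e2 : 0 < e / 2 by rewrite divr_gt0.
have [w0 h] := Fnorm _ e2.
near=> w; apply: bfun_norm_leP => [|x Bx]; first exact: ltW.
have := lB _ _ h _ Bx.
have : `|w0 x - w x| <= e / 2.
  rewrite -[_ - _]/((w0 - w) x) (le_trans (ler_bfun_norm _ Bx))//.
  by apply/ltW; near: w.
by rewrite bfunB /= !ler_norml; lra.
Unshelve. all: by end_near. Qed.

HB.instance Definition _ := Uniform_isComplete.Build bfun bfun_complete.

End bfun.

(** * Evaluation functionals *)

Lemma ler_dual_norm (R : realType) (W : normedModType R) (phi : dual W) w :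
  `|phi w| <= `|phi| * `|w|.
Proof.
have [->|w0] := eqVneq w 0; first by rewrite linear0 !normr0 mulr0.
have nw0 : `|w| != 0 by rewrite normr_eq0.
have : `|phi (`|w|^-1 *: w)| <= `|phi|.
  by apply: dual_norm_ub; rewrite normrZ normfV normr_id mulVf.
by rewrite linearZ/= normrM normfV normr_id ler_pdivrMl ?normr_gt0// mulrC.
Qed.

(** First-order condition at a minimum: moving by [s] along a segment changes a quadratic by
    [- 2 * s * a + s ^+ 2 * b], and this is nonnegative for every small [s] only if [a <= 0]. *)
Lemma quadratic_descent (R : realFieldType) (a b : R) :
  (forall s, 0 < s < 1 -> 2 * a <= s * b) -> a <= 0.
Proof.
move=> h; rewrite leNgt; apply/negP => a0.
have := h (1 / 2) ltac:(lra).
move=> ab; have b0 : 0 < b by lra.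
(* The value [s = 1 / 2] gives [4 * a <= b], so [s = a / b] is admissible; it yields
   [2 * a <= a]. *)
have /h : 0 < a / b < 1 by rewrite divr_gt0//= ltr_pdivrMr// mul1r; lra.
by rewrite divfK ?gt_eqF//; lra.
Qed.

Section representation.
Context {R : realType} {X : tvsType R} (B : set X).
Hypothesis compB : compact B.
Hypothesis B0 : B !=set0.
Hypothesis convB : forall (x y : X) (t : R), B x -> B y -> 0 < t < 1 ->
  B (t *: x + (1 - t) *: y).
Hypothesis symB : forall x, B x -> B (- x).

Let bfunN (w : bfun B) x : B x -> w (- x) = - w x.
Proof.
move=> Bx; have Sx := sub_linear_span Bx.
have := bfun_comb w (-1) 0 Sx Sx.
by rewrite scale0r addr0 scaleN1r mul0r addr0 mulN1r.
Qed.

(* Take [z] minimizing the squared distance from [(w z)_w] to [(phi w)_w].  By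
   convexity of [B] the residual, as a combination [u] of the [w]'s, attains its
   maximum on [B] at [z]; hence [phi u <= `|u| <= u z], i.e. the squared
   residual is nonpositive. *)
Lemma dual_bfun_interpolation (phi : dual (bfun B)) (s : seq (bfun B)) :
  `|phi| <= 1 -> exists2 z, B z & forall w, w \in s -> phi w = w z.
Proof.
move=> phi1.
pose J z := \sum_(w <- s) (phi w - w z) ^+ 2.
have cJ : {within B, continuous J}.
  apply/subspace_continuousP => x Bx; rewrite /J.
  apply: cvg_big => [|w _]; first exact: add_continuous.
  have cw : w y @[y --> within B (nbhs x)] --> w x.
    by have /subspace_continuousP := @bfun_continuous _ _ _ w; exact.
  under eq_fun do rewrite expr2; rewrite expr2.
  by apply: cvgM; apply: cvgB => //; exact: cvg_cst.
have [z0 /set_mem Bz0 z0min] := compact_EVT_min B0 compB cJ.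
exists z0 => //.
pose u : bfun B := \sum_(w <- s) (phi w - w z0) *: w.
have uE z : u z = \sum_(w <- s) (phi w - w z0) * w z.
  by rewrite /u; elim/big_rec2 : _ => // w r v _ <-.
have u_max z : B z -> u z <= u z0.
  move=> Bz; rewrite -subr_le0.
  apply: (@quadratic_descent _ _ (\sum_(w <- s) (w z - w z0) ^+ 2)) => t t01.
  have := z0min (t *: z + (1 - t) *: z0) (mem_set (convB Bz Bz0 t01)).
  have -> : J (t *: z + (1 - t) *: z0) = J z0 - t * (2 * (u z - u z0))
      + t * (t * (\sum_(w <- s) (w z - w z0) ^+ 2)).
    rewrite /J !uE -sumrB !mulr_sumr -sumrB -big_split/=; apply: eq_bigr => w _.
    by rewrite bfun_comb; [ring|exact: sub_linear_span|exact: sub_linear_span].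
  have t0 : 0 < t by case/andP : t01.
  by move=> h; rewrite -(ler_pM2l t0); move: h; lra.
have u_norm : `|u| <= u z0.
  apply: bfun_norm_leP => [|z Bz].
    by have := u_max _ (symB Bz0); rewrite bfunN//; lra.
  by rewrite ler_norml u_max// lerNl -bfunN// u_max//; exact: symB.
have : \sum_(w <- s) (phi w - w z0) ^+ 2 <= 0.
  rewrite (_ : \sum_(w <- s) _ = phi u - u z0).
    rewrite subr_le0 (le_trans _ u_norm)// (le_trans (ler_norm _))//.
    by rewrite (le_trans (ler_dual_norm _ _))// ler_piMl.
  rewrite uE /u linear_sum/= -sumrB; apply: eq_bigr => w _.
  by rewrite linearZ/= expr2 -mulrBr.
move=> le0 w ws.
have : \sum_(w <- s) (phi w - w z0) ^+ 2 == 0.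
  by rewrite eq_le le0 sumr_ge0// => v _; exact: sqr_ge0.
rewrite psumr_eq0 => [/allP/(_ _ ws)/=|v _]; last exact: sqr_ge0.
by rewrite sqrf_eq0 subr_eq0 => /eqP.
Qed.

(** Compactness passes from finitely many [w] to all of them. The sets of points of [B] that
    interpolate [phi] on a finite list are nonempty and directed under concatenation, and continuity
    of each [w] on [B] shows that a cluster point interpolates everywhere. *)
Lemma dual_bfun_representation (phi : dual (bfun B)) :
  `|phi| <= 1 -> exists2 z, B z & phi = bfun_eval B z.
Proof.
move=> phi1.
pose S (s : seq (bfun B)) := [set z | B z /\ forall w, w \in s -> phi w = w z].
pose F := filter_from setT S.
have FF : ProperFilter F.
  apply: filter_from_proper; last first.
    by move=> s _; have [z Bz hz] := dual_bfun_interpolation s phi1; exists z.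
  apply: filter_from_filter; first by exists [::].
  move=> s t _ _; exists (s ++ t) => // z [Bz h].
  by split; split=> // w ws; apply: h; rewrite mem_cat ws ?orbT.
have [|z [Bz Fz]] := compB FF; first by exists [::] => // z [].
exists z => //; apply/val_inj/funext => w /=.
apply/eqP; rewrite -subr_eq0 -normr_le0; apply/ler_addgt0Pl => e e0.
rewrite addr0.
have /subspace_continuousP/(_ z Bz)/cvgrPdist_le/(_ e e0) cw :=
  @bfun_continuous _ _ _ w.
have FS : F (S [:: w]) by exists [:: w].
have [y [[By hy] ywe]] := Fz _ _ FS cw.
by rewrite hy ?mem_seq1// distrC; exact: ywe.
Qed.

(** The two functionals are evaluations at distinct [x] and [y] in [B]. For [w] in the unit ball,
    the bound [1] at the dilated midpoint reads [|w x + w y| <= 2 / (1 + e)], uniformly in [w]. *)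
Lemma dual_bfun_strictly_convex :
  (forall x y, B x -> B y -> x <> y ->
    exists2 e : R, 0 < e & B (((1 + e) / 2) *: (x + y))) ->
  strictly_convex_norm (dual (bfun B)).
Proof.
move=> strB phi psi phi1 psi1 phipsi.
have [x Bx phiE] : exists2 z, B z & phi = bfun_eval B z.
  by apply: dual_bfun_representation; rewrite phi1.
have [y By psiE] : exists2 z, B z & psi = bfun_eval B z.
  by apply: dual_bfun_representation; rewrite psi1.
have [|e e0 Be] := strB _ _ Bx By.
  by move=> xy; apply: phipsi; rewrite phiE psiE xy.
apply: (@le_lt_trans _ _ (2 / (1 + e))); last by rewrite ltr_pdivrMr; lra.
apply: dual_norm_le => w w1.
have : `|w (((1 + e) / 2) *: (x + y))| <= 1.
  exact: le_trans (ler_bfun_norm _ Be) w1.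
rewrite scalerDr bfun_comb; try exact: sub_linear_span.
rewrite -mulrDr normrM gtr0_norm; last by lra.
rewrite phiE psiE /= -ler_pdivlMl; last by lra.
by rewrite mulr1 invf_div.
Qed.

End representation.

(** * Embeddings of compact sets into the weak* topology *)

Section compact_embedding.

Lemma compact_injective_homeomorphism (S T : topologicalType) (s0 : S)
    (K : set S) (f : S -> T) : hausdorff_space T -> compact K ->
  {within K, continuous f} -> {in K &, injective f} -> homeomorphism_on K f.
Proof.
move=> hT cK cf injf; split => //.
have /choice[g gP] : forall t, exists s, (f @` K) t -> K s /\ f s = t.
  move=> t; have [[s Ks fs]|nt] := pselect ((f @` K) t); first by exists s.
  by exists s0.
have gK : {in K, cancel f g}.
  move=> s sK; have [|Kg fg] := gP (f s).
    by exists s => //; exact: set_mem.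
  by apply: injf => //; exact: mem_set.
exists g; split => //.
apply/subspace_continuousP => _ [s Ks <-].
rewrite -[X in _ --> X]/(g (f s)) gK ?mem_set//.
move=> V; rewrite nbhsE => -[U [openU Us] UV].
have cKU : compact (K `&` ~` U).
  by apply: compact_closedI => //; exact: open_closedC.
have : closed (f @` (K `&` ~` U)).
  apply: compact_closed => //; apply: continuous_compact => //.
  by apply: continuous_subspaceW cf => x [].
move=> clf; have : nbhs (f s) (~` (f @` (K `&` ~` U))).
  apply: open_nbhs_nbhs; split; first exact: closed_openC.
  move=> [r [Kr nUr] frs]; apply: nUr.
  by rewrite (injf r s)// ?mem_set.
rewrite /= /nbhs/= => fsU; near=> t.
have [r Kr frt] : (f @` K) t by near: t; exact: withinT.
have nt : (~` (f @` (K `&` ~` U))) t.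
  by near: t; apply: cvg_within; exact: fsU.
have gt : g t = r by rewrite -frt gK ?mem_set.
apply: UV; rewrite -[X in U X]/(g t) gt; apply: contrapT => nUr.
by apply: nt; exists r.
Unshelve. all: by end_near. Qed.

Variables (R : realType) (W : normedModType R).

Lemma weak_star_eval_continuous (w : W) :
  continuous (fun phi : weak_star W => phi w : R^o).
Proof.
move=> phi.
have c : continuous (@dual_fun R W : weak_star W -> {ptws W -> R^o}).
  exact: initial_continuous.
have FF : Filter (nbhs (phi : weak_star W)) by exact: nbhs_filter.
have := (pointwise_cvgP (phi : W -> R^o) (fmap_filter _ FF)).1 (c phi) w.
exact.
Qed.

Lemma weak_star_hausdorff : hausdorff_space (weak_star W).
Proof.
move=> phi psi clus; apply/val_inj/funext => w /=.
apply: (@norm_hausdorff _ R^o) => A C phiA psiC.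
have [chi [chiA chiC]] := clus _ _ (weak_star_eval_continuous phiA)
  (weak_star_eval_continuous psiC).
by exists (chi w).
Qed.

Lemma weak_star_continuous (S : topologicalType) (g : S -> weak_star W) :
  (forall w, continuous (fun s => g s w : R^o)) -> continuous g.
Proof.
move=> cg; apply: continuous_comp_initial => s.
by apply/pointwise_cvgP => w; exact: cg.
Qed.

End compact_embedding.

Lemma bfun_eval_embedding (R : realType) (X : tvsType R) (B K : set X) :
  compact K -> K `<=` linear_span B ->
  (forall w : bfun B, {within K, continuous w}) ->
  (forall x y, K x -> K y -> x <> y -> exists w : bfun B, w x <> w y) ->
  embeds_linearly_weak_star K (bfun B).
Proof.
move=> cK KB cw sep; exists (bfun_eval B); split.
  move=> a x y Kx Ky; apply/val_inj/funext => w.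
  by apply: bfun_linear; apply: (linear_span_sub KB).
apply: compact_injective_homeomorphism => //.
- exact: (0 : X).
- exact: weak_star_hausdorff.
- by apply: weak_star_continuous => w; exact: cw.
- move=> x y /set_mem Kx /set_mem Ky Txy; apply: contrapT => xy.
  have [w] := sep _ _ Kx Ky xy; apply.
  by have /(congr1 (fun phi : dual _ => phi w)) := Txy.
Qed.

(** * The convex body *)

Lemma lower_semicontinuous_onP (R : realType) (X : topologicalType)
    (K : set X) (f : X -> R) :
  lower_semicontinuous_on K f <->
  forall x a, K x -> a < f x -> \forall y \near within K (nbhs x), a < f y.
Proof.
split=> [lf x a Kx afx|lf x a].
  have [|V xV Va] := lf x a; first by rewrite lte_fin.
  have : within K (nbhs x) V by rewrite nbhs_subspace_in.
  by apply: filterS => y /Va; rewrite lte_fin.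
rewrite lte_fin => afx.
have [Kx|nKx] := pselect (K x).
  exists [set y | a < f y]; last by move=> y /=; rewrite lte_fin.
  by have := lf x a Kx afx; rewrite nbhs_subspace_in.
exists [set x]; last by move=> _ ->; rewrite lte_fin.
by case: (nbhs_subspaceP K x) => [/nKx//|_] y.
Qed.

(** * Reduction to a function with values between 0 and 1 *)

Section normalization.
Context {R : realType} {X : tvsType R} (K : set X) (f : X -> R).
Hypothesis hX : hausdorff_space X.
Hypothesis compK : compact K.
Hypothesis convK : forall (x y : X) (t : R), K x -> K y -> 0 <= t <= 1 ->
  K (t *: x + (1 - t) *: y).
Hypothesis lscf : forall x a, K x -> a < f x ->
  \forall y \near within K (nbhs x), a < f y.

(** Near each [x] in [K] the function exceeds [f x - 1]; compactness, used as a covering property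
    along the filter [-oo], makes one bound serve all of [K]. *)
Lemma lower_semicontinuous_lower_bound : exists m, forall x, K x -> m <= f x.
Proof.
have /compact_near_coveringP cov := compK.
have : \forall a \near -oo, K `<=` [set x | K x -> a < f x].
  apply: (cov R -oo (fun a x => K x -> a < f x)) => x Kx.
  have lx : f x - 1 < f x by lra.
  have := lscf Kx lx => h.
  exists ([set y | K y -> f x - 1 < f y], [set a | a < f x - 1]).
    by split => //=; exists (f x - 1); split => //; exact: num_real.
  by move=> [y a] /= [hy ha] Ky; exact: lt_trans ha (hy Ky).
move=> [m [_ hm]]; exists (m - 1) => x Kx; apply/ltW.
by apply: (hm (m - 1) _ x) => //; lra.
Qed.

(** A pair encodes a homothety by its translation and its ratio. *)
Let hom (p : X * R) (x : X) := p.1 + p.2 *: x.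

Let inner := [set p : X * R | 0 < p.2 /\ forall x, K x -> K (hom p x)].

(** The homothety [p] precomposed with the contraction of ratio [m] towards [y]. *)
Let shrink (p : X * R) (y : X) (m : R) : X * R :=
  (p.1 + (p.2 * (1 - m)) *: y, p.2 * m).

Let shrinkE p y m x :
  hom (shrink p y m) x = hom p (m *: x + (1 - m) *: y).
Proof.
by rewrite /hom /shrink/= scalerDr !scalerA -addrA [_ + (_ * m) *: _]addrC.
Qed.

(** As [m] tends to [0] the contracted copy collapses to [hom p y], near which [f] exceeds [a] on
    [K]; compactness of [K] makes this uniform in [x]. *)
Let shrink_above p y a : inner p -> K y -> a < f (hom p y) ->
  exists2 m, 0 < m < 1 & forall x, K x -> a < f (hom (shrink p y m) x).
Proof.
move=> [p0 pK] Ky ay.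
have /compact_near_coveringP cov := compK.
have : \forall m \near (0 : R^o),
    K `<=` [set x | K (hom (shrink p y m) x) -> a < f (hom (shrink p y m) x)].
  apply: (cov R^o (nbhs 0)
    (fun m x => K (hom (shrink p y m) x) -> a < f (hom (shrink p y m) x))).
  move=> x Kx.
  have c : {for (x, 0 : R^o), continuous (fun z : X * R^o =>
      p.1 + p.2 *: (z.2 *: z.1 + (1 - z.2) *: y))}.
    apply: continuousD_tvs; first exact: cvg_cst.
    apply: continuousZ_tvs; first exact: cvg_cst.
    apply: continuousD_tvs; apply: continuousZ_tvs.
    - exact: cvg_snd.
    - exact: cvg_fst.
    - by apply: cvgB; [exact: cvg_cst|exact: cvg_snd].
    - exact: cvg_cst.
  have : nbhs (hom p y) [set z | K z -> a < f z] by exact: lscf (pK _ Ky) ay.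
  have {1}-> : hom p y = p.1 + p.2 *: (0 *: x + (1 - 0) *: y).
    by rewrite scale0r add0r subr0 scale1r.
  move=> /c h; apply: (@filterS _ (nbhs (x, 0 : R^o)) _ _ _ _ h) => -[x' m] /=.
  by rewrite shrinkE.
move=> [e /= e0 he]; pose m := Num.min (e / 2) (1 / 2).
have m0 : 0 < m by rewrite lt_min; apply/andP; split; lra.
have me : m <= e / 2 by rewrite ge_min lexx.
have m1 : m <= 1 / 2 by rewrite ge_min lexx orbT.
exists m; first by rewrite m0/=; lra.
move=> x Kx; apply: (he m) => //=.
  by rewrite sub0r normrN gtr0_norm//; lra.
by rewrite shrinkE; apply: pK; apply: convK => //; rewrite ltW//=; lra.
Qed.

(* Otherwise one builds decreasing homothetic copies of [K] in [K], the n-th one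
   inside [n < f]; at a common point [f] would be infinite. *)
Lemma bounded_homothety x0 : K x0 -> exists c l M,
  [/\ 0 < l, forall x, K x -> K (c + l *: x) &
      forall x, K x -> f (c + l *: x) <= M].
Proof.
move=> Kx0; apply: contrapT => nex.
have unbounded p a : inner p -> exists2 y, K y & a < f (hom p y).
  move=> [p0 pK]; apply: contrapT => ny; apply: nex.
  exists p.1, p.2, a; split => // x Kx; rewrite leNgt; apply/negP => h.
  by apply: ny; exists x.
have step (p : X * R) (n : nat) : exists q, inner p -> inner q /\
    (forall x, K x -> n%:R < f (hom q x)) /\
    forall x, K x -> exists2 y, K y & hom q x = hom p y.
  have [hp|] := pselect (inner p); last by exists p.
  have [y Ky ny] := unbounded _ n%:R hp.
  have [m /andP[m0 m1] hm] := shrink_above hp Ky ny.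
  have hK x : K x -> K (m *: x + (1 - m) *: y).
    by move=> Kx; apply: convK => //; rewrite !ltW.
  exists (shrink p y m) => _; split; [split|split] => //.
  - by rewrite /shrink/= mulr_gt0//; case: hp.
  - by move=> x Kx; rewrite shrinkE; apply: hp.2; exact: hK.
  - move=> x Kx; rewrite shrinkE.
    by exists (m *: x + (1 - m) *: y); first exact: hK.
have /choice[next nextP] : forall pn : (X * R) * nat, exists q,
    inner pn.1 -> inner q /\
    (forall x, K x -> pn.2%:R < f (hom q x)) /\
    forall x, K x -> exists2 y, K y & hom q x = hom pn.1 y.
  by move=> [p n]; exact: step.
(* The sequence starts from the identity [(0, 1)], and [f] exceeds [n] on the copy of index [n.+1];
   hence the final contradiction evaluates [f] in [C n.+1]. *)
pose p := fix p n := if n is n'.+1 then next (p n', n') else (0, 1).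
have pP n : inner (p n).
  elim: n => [|n ih]; last by have [] := nextP (p n, n) ih.
  by split => //= x Kx; rewrite /hom add0r scale1r.
pose C n := hom (p n) @` K.
have CS n : C n.+1 `<=` C n.
  move=> _ [x Kx <-]; have [_ [_ /(_ x Kx)[y Ky h]]] := nextP (p n, n) (pP n).
  by exists y.
have Cle n m : (n <= m)%N -> C m `<=` C n.
  by elim: m => [|m ih]; [rewrite leqn0 => /eqP ->
    |rewrite leq_eqVlt => /predU1P[->//|/ih h]; exact: subset_trans (CS m) h].
pose F := filter_from setT C.
have FF : ProperFilter F.
  apply: filter_from_proper; last by move=> n _; exists (hom (p n) x0), x0.
  apply: filter_from_filter; first by exists 0%N.
  move=> n m _ _; exists (maxn n m) => // z Cz.
  by split; apply: Cle Cz; rewrite ?leq_maxl ?leq_maxr.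
have [|z [Kz Fz]] := compK FF.
  by exists 0%N => // _ [x Kx <-]; exact: (pP 0%N).2.
(* Each copy is compact, hence closed, so it contains the cluster point. *)
have Cz n : C n z.
  have : compact (C n).
    apply: continuous_compact => //; apply: continuous_subspaceT.
    exact: continuous_homothety.
  move/(compact_closed hX); apply => V zV.
  by apply: Fz => //; exists n.
have [n nz] : exists n : nat, f z < n%:R.
  exists (Num.truncn `|f z|).+1.
  by rewrite (le_lt_trans (ler_norm _))// truncnS_gt.
have [x Kx xz] := Cz n.+1.
have [_ [/(_ x Kx) h _]] := nextP (p n, n) (pP n).
by move: h nz; rewrite -[next _]/(p n.+1) xz/=; lra.
Qed.

Hypothesis scf : strictly_convex_on K f.

Lemma unit_strictly_convex_function : K !=set0 -> exists g : X -> R,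
  [/\ forall x, K x -> 0 <= g x <= 1, strictly_convex_on K g &
    forall x a, K x -> a < g x -> \forall y \near within K (nbhs x), a < g y].
Proof.
move=> [x0 Kx0].
have [m fm] := lower_semicontinuous_lower_bound.
have [c [l [M [l0 hK fM]]]] := bounded_homothety Kx0.
(* The added [1] keeps the divisor positive even when [M = m]. *)
have Mm : 0 < M - m + 1.
  by have := fM _ Kx0; have := fm _ (hK _ Kx0); lra.
exists (fun x => (f (c + l *: x) - m) / (M - m + 1)); split.
- move=> x Kx; rewrite divr_ge0/=; last 2 first.
  + by rewrite subr_ge0; apply: fm; exact: hK.
  + exact: ltW.
  by rewrite ler_pdivrMr// mul1r; have := fM _ Kx; lra.
- move=> x y t Kx Ky xy t01.
  have -> : c + l *: (t *: x + (1 - t) *: y)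
      = t *: (c + l *: x) + (1 - t) *: (c + l *: y).
    rewrite !scalerDr !scalerA addrACA -scalerDl subrKC scale1r.
    by rewrite [t * l]mulrC [(1 - t) * l]mulrC.
  rewrite !mulrA -mulrDl ltr_pM2r ?invr_gt0//.
  have : c + l *: x <> c + l *: y.
    by move=> /addrI /(scalerI (lt0r_neq0 l0)).
  by move=> /(scf (hK _ Kx) (hK _ Ky)) /(_ t01); lra.
- move=> x a Kx; rewrite ltr_pdivlMr// ltrBrDr => ax.
  have /continuous_homothety h := lscf (hK _ Kx) ax.
  apply: (@filterS _ (nbhs x) _ _ _ _ h) => y /= {}h Ky.
  by rewrite ltr_pdivlMr// ltrBrDr; apply: h; exact: hK.
Qed.

End normalization.

(** * The symmetric body of differences of cone points *)

Section body.
Context {R : realType} {X : tvsType R} (K : set X) (g : X -> R).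
Hypothesis hX : hausdorff_space X.
Hypothesis compK : compact K.
Hypothesis convK : forall (x y : X) (t : R), K x -> K y -> 0 <= t <= 1 ->
  K (t *: x + (1 - t) *: y).
Hypothesis g01 : forall x, K x -> 0 <= g x <= 1.
Hypothesis scg : strictly_convex_on K g.
Hypothesis lscg : forall x a, K x -> a < g x ->
  \forall y \near within K (nbhs x), a < g y.

(** The cost belongs to the pair and not to the vector [a *: x], which may have several such
    representations. The term [a * g x] handles distinct directions, and the square handles distinct
    multiples of the same point. *)
Definition cone_cost (a : R) (x : X) := a ^+ 2 + a * g x.

Definition body : set X := [set z | exists a x b y,
  [/\ 0 <= a /\ K x, 0 <= b /\ K y, cone_cost a x + cone_cost b y <= 1 &
      z = a *: x - b *: y]].

Lemma cone_cost_ge0 a x : 0 <= a -> K x -> 0 <= cone_cost a x.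
Proof.
move=> a0 Kx; have /andP[g0 _] := g01 Kx.
by rewrite addr_ge0 ?sqr_ge0// mulr_ge0.
Qed.

Let convex_g x y s : K x -> K y -> 0 <= s <= 1 ->
  g (s *: x + (1 - s) *: y) <= s * g x + (1 - s) * g y.
Proof.
move=> Kx Ky /andP[s0 s1].
have [->|/eqP xy] := eqVneq x y.
  by rewrite -scalerDl -mulrDl subrKC scale1r mul1r.
have [->|sn0] := eqVneq s 0.
  by rewrite !scale0r !mul0r !subr0 !add0r scale1r mul1r.
have [->|sn1] := eqVneq s 1.
  by rewrite subrr !scale0r !mul0r !addr0 scale1r mul1r.
apply/ltW/scg => //; rewrite !lt_neqAle s0 s1 eq_sym sn0 sn1//.
Qed.

Lemma cone_cost_convex a x b y t :
  0 <= a -> 0 <= b -> K x -> K y -> 0 < t < 1 ->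
  exists c z, [/\ 0 <= c /\ K z,
    c *: z = t *: (a *: x) + (1 - t) *: (b *: y),
    cone_cost c z <= t * cone_cost a x + (1 - t) * cone_cost b y &
    a *: x <> b *: y ->
      cone_cost c z < t * cone_cost a x + (1 - t) * cone_cost b y].
Proof.
move=> a0 b0 Kx Ky /andP[t0 t1].
have ta0 : 0 <= t * a by rewrite mulr_ge0// ltW.
have tb0 : 0 <= (1 - t) * b by rewrite mulr_ge0//; lra.
pose c := t * a + (1 - t) * b.
(* When [c = 0] both coefficients vanish, so both cone points are [0] and any point of [K] can serve
   as [z]. *)
have [c0|cn0] := eqVneq c 0.
  have ab0 : a = 0 /\ b = 0.
    have tn0 : (t == 0) = false by rewrite gt_eqF.
    have tn1 : (1 - t == 0) = false by rewrite gt_eqF// subr_gt0.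
    move: c0 => /eqP; rewrite /c paddr_eq0// !mulf_eq0 tn0 tn1/=.
    by move=> /andP[/eqP -> /eqP ->].
  have [-> ->] := ab0; exists 0, x.
  rewrite !scale0r !scaler0 addr0 /cone_cost !mul0r expr0n/= addr0 !mulr0 addr0.
  by split.
have c0 : 0 < c by rewrite lt_neqAle eq_sym cn0/= addr_ge0.
pose s := t * a / c.
have s1E : 1 - s = (1 - t) * b / c by rewrite /s /c; field.
have s01 : 0 <= s <= 1.
  by rewrite divr_ge0//= ?(ltW c0)// ler_pdivrMr// mul1r /c; lra.
have cs : c * s = t * a by rewrite /s; field.
have cs1 : c * (1 - s) = (1 - t) * b by rewrite s1E; field.
exists c, (s *: x + (1 - s) *: y).
(* The convexity defect splits into two nonnegative terms. The first is positive if [a] and [b]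
   differ; otherwise [s = t], the points [x] and [y] differ, and strict convexity of [g] makes the
   second positive. *)
have costE : t * cone_cost a x + (1 - t) * cone_cost b y
     - cone_cost c (s *: x + (1 - s) *: y)
   = t * (1 - t) * (a - b) ^+ 2
     + c * (s * g x + (1 - s) * g y - g (s *: x + (1 - s) *: y)).
  set G := g (_ + _).
  have -> : c * (s * g x + (1 - s) * g y - G)
      = t * a * g x + (1 - t) * b * g y - c * G.
    by rewrite -cs -cs1; ring.
  by rewrite /cone_cost -/G /c; ring.
have gs := convex_g Kx Ky s01.
have sq0 : 0 <= t * (1 - t) * (a - b) ^+ 2.
  by rewrite mulr_ge0 ?sqr_ge0// mulr_ge0//; lra.
have cg0 : 0 <= c * (s * g x + (1 - s) * g y - g (s *: x + (1 - s) *: y)).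
  by rewrite mulr_ge0 ?(ltW c0)// subr_ge0.
split.
- by split; [exact: ltW|exact: convK].
- by rewrite scalerDr !scalerA cs cs1.
- by rewrite -subr_ge0 costE addr_ge0.
- move=> axby; rewrite -subr_gt0 costE.
  have [ab|ab] := eqVneq a b; last first.
    have ab2 : 0 < (a - b) ^+ 2 by rewrite exprn_even_gt0//= subr_eq0.
    by rewrite ltr_pwDl// mulr_gt0// mulr_gt0// subr_gt0.
  have xy : x <> y by move=> xy; apply: axby; rewrite ab xy.
  have st : s = t by move: cn0; rewrite /s /c ab => ?; field.
  rewrite ltr_wpDl// mulr_gt0// subr_gt0 st; apply: scg => //.
  by rewrite t0.
Qed.

(** The cost is [1 / 4 + g x / 2], at most [3 / 4]; with coefficient [1] it could reach [2]. *)
Lemma body_half x : K x -> body (2^-1 *: x).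
Proof.
move=> Kx; exists 2^-1, x, 0, x.
rewrite scale0r subr0 /cone_cost mul0r expr0n/= !addr0.
split => //.
by have := g01 Kx; lra.
Qed.

Lemma sub_span_body : K `<=` linear_span body.
Proof.
move=> x Kx; rewrite -[x](@scalerKV _ _ 2)// -[_ *: _]addr0.
apply: linear_spanP; last exact: linear_span0.
by apply: sub_linear_span; exact: body_half.
Qed.

Lemma bodyN z : body z -> body (- z).
Proof.
move=> [a [x [b [y [ax bx cost ->]]]]]; exists b, y, a, x.
by rewrite opprB [cone_cost b y + _]addrC.
Qed.

(** The positive and the negative cone components are mixed separately. Distinct differences differ
    in at least one component, which makes the total cost strictly smaller; [S] records it so that
    the slack can be spent on a dilation. *)
Lemma body_mix z z' t : body z -> body z' -> 0 < t < 1 ->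
  exists S c x d y, [/\ 0 <= c /\ K x, 0 <= d /\ K y,
    cone_cost c x + cone_cost d y = S,
    t *: z + (1 - t) *: z' = c *: x - d *: y &
    S <= 1 /\ (z <> z' -> S < 1)].
Proof.
move=> [a [x [b [y [[a0 Kx] [b0 Ky] cost ->]]]]].
move=> [a' [x' [b' [y' [[a'0 Kx'] [b'0 Ky'] cost' ->]]]]] t01.
have [c [u [cu cuE costc costc_lt]]] := cone_cost_convex a0 a'0 Kx Kx' t01.
have [d [v [dv dvE costd costd_lt]]] := cone_cost_convex b0 b'0 Ky Ky' t01.
exists (cone_cost c u + cone_cost d v), c, u, d, v; split => //.
  by rewrite cuE dvE !scalerBr opprD addrACA.
have total : t * (cone_cost a x + cone_cost b y)
    + (1 - t) * (cone_cost a' x' + cone_cost b' y') <= 1.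
  have /andP[t0 t1] := t01.
  apply: (@le_trans _ _ (t * 1 + (1 - t) * 1)); last by lra.
  by rewrite lerD// ler_wpM2l//; lra.
have costE : t * (cone_cost a x + cone_cost b y)
    + (1 - t) * (cone_cost a' x' + cone_cost b' y') =
    t * cone_cost a x + (1 - t) * cone_cost a' x'
    + (t * cone_cost b y + (1 - t) * cone_cost b' y') by ring.
rewrite costE in total.
split=> [|zz']; first exact: le_trans (lerD costc costd) total.
apply: lt_le_trans total.
have [axx|axx] := pselect (a *: x = a' *: x').
  by apply: ler_ltD => //; apply: costd_lt => byy; apply: zz'; rewrite axx byy.
by apply: ltr_leD => //; exact: costc_lt.
Qed.

Lemma body_convex z z' t : body z -> body z' -> 0 < t < 1 ->
  body (t *: z + (1 - t) *: z').
Proof.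
move=> Bz Bz' t01.
have [S [c [x [d [y [cx dy SE zE [S1 _]]]]]]] := body_mix Bz Bz' t01.
by exists c, x, d, y; split => //; rewrite SE.
Qed.

Lemma cone_cost_scale a x e : 0 <= a -> K x -> 0 <= e ->
  cone_cost ((1 + e) * a) x <= (1 + e) ^+ 2 * cone_cost a x.
Proof.
move=> a0 Kx e0; have /andP[gx0 _] := g01 Kx.
have ag0 : 0 <= a * g x by rewrite mulr_ge0.
have : 0 <= e * (1 + e) * (a * g x) by rewrite mulr_ge0// mulr_ge0//; lra.
by rewrite /cone_cost; lra.
Qed.

Lemma body_strict z z' : body z -> body z' -> z <> z' ->
  exists2 e : R, 0 < e & body (((1 + e) / 2) *: (z + z')).
Proof.
have half01 : 0 < (2^-1 : R) < 1.
  by rewrite invr_gt0 ltr0n invf_lt1 ?ltr0n ?ltr1n.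
move=> Bz Bz' zz'.
have [S [c [x [d [y [[c0 Kx] [d0 Ky] SE zE [_ /(_ zz') S1]]]]]]] :=
  body_mix Bz Bz' half01.
clear zz'; have S0 : 0 <= S by rewrite -SE addr_ge0// cone_cost_ge0.
(* With this choice [S = 1 - 4 * e], so the dilated cost is at most
   [(1 + e) ^+ 2 * (1 - 4 * e) <= 1]. *)
pose e := (1 - S) / 4.
have e0 : 0 < e by rewrite /e; lra.
exists e => //; exists ((1 + e) * c), x, ((1 + e) * d), y; split.
- by split => //; rewrite mulr_ge0//; lra.
- by split => //; rewrite mulr_ge0//; lra.
- have := cone_cost_scale c0 Kx (ltW e0).
  have := cone_cost_scale d0 Ky (ltW e0).
  have : (1 + e) ^+ 2 * cone_cost c x + (1 + e) ^+ 2 * cone_cost d y <= 1.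
    rewrite -mulrDr SE (_ : S = 1 - 4 * e); last by rewrite /e; field.
    have e4 : e <= 1 / 4 by rewrite /e; lra.
    by nra.
  by lra.
- rewrite -!scalerA -scalerBr -zE -[1 - 2^-1](_ : 2^-1 = _); last by field.
  by rewrite -scalerDr scalerA.
Qed.

Let epigraph := [set p : X * R^o | K p.1 /\ g p.1 <= p.2 <= 1].

(** Lower semicontinuity makes the epigraph closed in the compact product of [K] and the unit
    interval: if [u < g x], a level [a] strictly between them separates [(x, u)] from the
    epigraph. *)
Let epigraph_compact : compact epigraph.
Proof.
have cK01 : compact (K `*` `[0, 1] : set (X * R^o)).
  by apply: compact_setX => //; exact: segment_compact.
move=> F FF FE.
have [|[x u] [[/= Kx u01] Fxu]] := cK01 F FF.
  apply: filterS FE => -[x u] [/= Kx /andP[gu u1]]; split => //=.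
  by rewrite in_itv/= u1 andbT; have /andP[g0 _] := g01 Kx; exact: le_trans gu.
exists (x, u); split => //; split => //=.
move: u01; rewrite /= in_itv/= => /andP[_ ->]; rewrite andbT.
rewrite leNgt; apply/negP => ug.
pose a := (u + g x) / 2.
have ua : u < a by rewrite /a; lra.
have ag : a < g x by rewrite /a; lra.
have nxu : nbhs (x, u : R^o) [set p | (K p.1 -> a < g p.1) /\ p.2 < a].
  exists ([set y | K y -> a < g y], [set v | v < a]).
    by split; [exact: lscg|exact: lt_nbhsl].
  by move=> [y v] [].
have [[y v] [[/= Ky /andP[gv _]] [/= /(_ Ky) ay va]]] := Fxu _ _ FE nxu.
by have := lt_trans ay (le_lt_trans gv va); rewrite ltxx.
Qed.

(* The cost is not continuous in [x], but [a ^+ 2 + a * u] is continuous on the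
   compact epigraph of [g] truncated at height [1]. *)
Lemma body_compact : compact body.
Proof.
pose T := (R^o * (X * R^o))%type.
pose cost (c : T) : R^o := c.1 * c.1 + c.1 * c.2.2.
pose C : set T := `[0, 1] `*` epigraph.
pose P := (C `*` C) `&` [set cd : T * T | cost cd.1 + cost cd.2 <= 1].
have cC : compact C.
  by apply: compact_setX => //; exact: segment_compact.
have ccost (h : T * T -> T) : continuous h -> continuous (cost \o h).
  move=> ch p; apply: continuous_comp; first exact: ch.
  apply: cvgD; apply: cvgM; try exact: cvg_fst.
  by apply: (@continuous_comp _ _ _ snd snd); exact: cvg_snd.
have cP : compact P.
  apply: compact_closedI; first exact: compact_setX.
  apply: (@preimage_closed _ R^o (fun cd : T * T => cost cd.1 + cost cd.2)
    [set r | r <= 1]); last exact: closed_le.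
  move=> p _.
  by apply: cvgD; apply: ccost => q; [exact: cvg_fst|exact: cvg_snd].
pose ev (cd : T * T) : X := cd.1.1 *: cd.1.2.1 + (- cd.2.1) *: cd.2.2.1.
have cev : continuous ev.
  have c1 : continuous (fst : T * T -> T) by move=> q; exact: cvg_fst.
  have c2 : continuous (snd : T * T -> T) by move=> q; exact: cvg_snd.
  have f1 : continuous (fun c : T => c.1) by move=> q; exact: cvg_fst.
  have f2 : continuous (fun c : T => c.2.1).
    move=> q; apply: (@continuous_comp _ _ _ snd fst); first exact: cvg_snd.
    exact: cvg_fst.
  move=> p; suff : {for p, continuous (fun cd : T * T =>
      cd.1.1 *: cd.1.2.1 + (- cd.2.1) *: cd.2.2.1)} by [].
  apply: continuousD_tvs; apply: continuousZ_tvs.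
  - by apply: (@continuous_comp _ _ _ fst fst); [exact: c1|exact: f1].
  - by apply: (@continuous_comp _ _ _ fst (fun c : T => c.2.1));
      [exact: c1|exact: f2].
  - apply: cvgN.
    by apply: (@continuous_comp _ _ _ snd fst); [exact: c2|exact: f1].
  - by apply: (@continuous_comp _ _ _ snd (fun c : T => c.2.1));
      [exact: c2|exact: f2].
rewrite (_ : body = ev @` P).
  by apply: continuous_compact => //; exact: continuous_subspaceT.
(* Total cost at most [1] bounds each coefficient by [1], so the compact range [[0, 1]] in [C]
   captures all of [body]. *)
have le1 (a r : R) : a ^+ 2 + r <= 1 -> 0 <= r -> a <= 1.
  by move=> h r0; rewrite leNgt; apply/negP => a1; nra.
(* In one direction the heights are chosen equal to [g]; in the other, lowering the heights to [g]
   can only lower the cost, the coefficients being nonnegative. *)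
apply/seteqP; split.
- move=> _ [a [x [b [y [[a0 Kx] [b0 Ky] cost1 ->]]]]].
  exists ((a, (x, g x)), (b, (y, g y))); last by rewrite /ev/= scaleNr.
  have /andP[gx0 gx1] := g01 Kx; have /andP[gy0 gy1] := g01 Ky.
  have cx := cone_cost_ge0 a0 Kx; have cy := cone_cost_ge0 b0 Ky.
  have agx : 0 <= a * g x by rewrite mulr_ge0.
  have bgy : 0 <= b * g y by rewrite mulr_ge0.
  split; last by rewrite /cost/= -!expr2.
  split; split => /=; rewrite ?in_itv/= ?a0 ?b0 ?lexx ?gx1 ?gy1//.
  + by apply: (le1 a (a * g x)) => //; rewrite -/(cone_cost a x); lra.
  + by split => //=; rewrite lexx gx1.
  + by apply: (le1 b (b * g y)) => //; rewrite -/(cone_cost b y); lra.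
  + by split => //=; rewrite lexx gy1.
- move=> _ [[[a [x u]] [b [y v]]] [[[/= a01 [/= Kx /andP[gu _]]]
    [/= b01 [/= Ky /andP[gv _]]]] cost1] <-].
  move: a01 b01; rewrite !in_itv/= => /andP[a0 _] /andP[b0 _].
  exists a, x, b, y; split => //; last by rewrite /ev/= scaleNr.
  move: cost1; rewrite /cost/= /cone_cost !expr2.
  have := ler_wpM2l a0 gu; have := ler_wpM2l b0 gv; lra.
Qed.

(** Continuity is given on [body], which may fail to contain [K]; it transfers through
    [w x = 2 * w (2^-1 *: x)], as [K] halved lies in [body]. *)
Lemma bfun_body_continuous (w : bfun body) : {within K, continuous w}.
Proof.
apply/subspace_continuousP => x Kx; apply/cvgrPdist_le => e e0.
have /subspace_continuousP/(_ _ (body_half Kx))/cvgrPdist_le :=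
  @bfun_continuous _ _ _ w.
have e2 : 0 < e / 2 by lra.
have c : {for x, continuous (fun y : X => 2^-1 *: y)}.
  by apply: continuousZ_tvs; [exact: cvg_cst|exact: cvg_id].
move=> /(_ _ e2) /c h; apply: (@filterS _ (nbhs x) _ _ _ _ h) => y /= {}h Ky.
have wE z : K z -> w z = 2 * w (2^-1 *: z).
  move=> Kz; have Sz := sub_linear_span (body_half Kz).
  have := bfun_comb w 2 0 Sz Sz.
  by rewrite scale0r mul0r !addr0 scalerA divff// scale1r.
rewrite -[from_subspace _ _ _]/(w x) -[from_subspace _ _ y]/(w y).
rewrite (wE x Kx) (wE y Ky) -mulrBr normrM ger0_norm// mulrC -ler_pdivlMr//.
exact: h (body_half Ky).
Qed.

(** A separating continuous functional, set to [0] off the span to meet the convention of [is_bfun];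
    compactness of [body] bounds it there. *)
Lemma bfun_body_separates x y : K x -> K y -> x <> y ->
  exists w : bfun body, w x <> w y.
Proof.
move=> Kx Ky /eqP xy.
have [L [linL contL Lxy]] := continuous_scalar_separates hX xy.
pose w z : R^o := if pselect (linear_span body z) then L z else 0.
have wL z : linear_span body z -> w z = L z by rewrite /w; case: pselect.
have cL : {within body, continuous L} by exact: continuous_subspaceT.
have wP : w \in is_bfun body.
  apply/asboolP; split.
  - by move=> a u v Bu Bv; rewrite !wL//; [exact: linL|exact: linear_spanP].
  - apply: subspace_eq_continuous cL => z /set_mem Bz.
    by rewrite -[RHS]/(w z) wL//; exact: sub_linear_span.
  - have B0 : body !=set0 by exists (2^-1 *: x); exact: body_half.
    have cnL : {within body, continuous (fun z => `|L z|)}.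
      by move=> z; apply: cvg_norm; exact: cL.
    have [z Bz zmax] := compact_EVT_max B0 body_compact cnL.
    exists `|L z| => u Bu; rewrite wL; last exact: sub_linear_span.
    by apply: zmax; exact: mem_set.
  - by move=> z nz; rewrite /w; case: pselect.
by exists (Bfun wP) => /=; rewrite !wL; [exact/eqP|exact: sub_span_body..].
Qed.

Lemma body_embedding : K !=set0 -> exists W : completeNormedModType R,
  strictly_convex_norm (dual W) /\ embeds_linearly_weak_star K W.
Proof.
move=> [x0 Kx0]; exists (bfun body); split.
- apply: dual_bfun_strictly_convex.
  + exact: body_compact.
  + by exists (2^-1 *: x0); exact: body_half.
  + exact: body_convex.
  + exact: bodyN.
  + exact: body_strict.
- apply: bfun_eval_embedding => //.
  + exact: sub_span_body.
  + exact: bfun_body_continuous.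
  + exact: bfun_body_separates.
Qed.

End body.

(** * From a strictly convex dual norm to the function *)

Lemma strictly_convex_norm_sqr (R : realType) (Z : normedModType R)
    (x y : Z) (t : R) :
  strictly_convex_norm Z -> x <> y -> 0 < t < 1 ->
  `|t *: x + (1 - t) *: y| ^+ 2 < t * `|x| ^+ 2 + (1 - t) * `|y| ^+ 2.
Proof.
move=> scZ xy /andP[t0 t1].
have t'0 : 0 < 1 - t by rewrite subr_gt0.
have normZ s (z : Z) : 0 <= s -> `|s *: z| = s * `|z|.
  by move=> s0; rewrite normrZ ger0_norm.
have norm_le : `|t *: x + (1 - t) *: y| <= t * `|x| + (1 - t) * `|y|.
  by rewrite (le_trans (ler_normD _ _))// !normZ// ltW.
(* For unequal norms the strict convexity of the square of a real number suffices; for equal norms,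
   rescaling to the unit sphere brings in the strict convexity of the norm. *)
have [xyE|xyN] := eqVneq `|x| `|y|; last first.
  apply: (@le_lt_trans _ _ ((t * `|x| + (1 - t) * `|y|) ^+ 2)).
    by rewrite ler_sqr ?nnegrE ?addr_ge0 ?mulr_ge0// ltW.
  rewrite -subr_gt0 [ltRHS](_ : _ = t * (1 - t) * (`|x| - `|y|) ^+ 2);
    last by ring.
  have xy2 : 0 < (`|x| - `|y|) ^+ 2 by rewrite exprn_even_gt0//= subr_eq0.
  by rewrite mulr_gt0// mulr_gt0.
have y0 : 0 < `|y|.
  rewrite lt_neqAle normr_ge0 andbT eq_sym; apply/negP => /eqP y0.
  apply: xy; move: xyE; rewrite y0 => /normr0_eq0 ->.
  by apply/esym/normr0_eq0.
have unit (z : Z) : `|z| = `|y| -> `| `|y|^-1 *: z | = 1.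
  by move=> zy; rewrite normZ ?invr_ge0 ?ltW// zy mulVf// gt_eqF.
have sum_lt : `|x + y| < 2 * `|y|.
  have := scZ _ _ (unit x xyE) (unit y erefl).
  rewrite -scalerDr normZ ?invr_ge0 ?ltW// ltr_pdivrMl// mulrC; apply.
  by move=> /(scalerI (invr_neq0 (lt0r_neq0 y0))).
suff lt_y : `|t *: x + (1 - t) *: y| < `|y|.
  rewrite xyE -mulrDl subrKC mul1r ltr_sqr ?nnegrE//.
(* The point lies between the midpoint and the nearer endpoint, so it is a positive multiple of
   [x + y] plus a nonnegative multiple of that endpoint. *)
have [t2|t2] := leP t (1 / 2).
  have -> : t *: x + (1 - t) *: y = t *: (x + y) + (1 - 2 * t) *: y.
    by rewrite scalerDr -addrA -scalerDl; congr (_ + _ *: _); ring.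
  apply: le_lt_trans (ler_normD _ _) _.
  rewrite !normZ ?(ltW t0)//; last by clear -t2; lra.
  have := ltr_pM2l t0 `|x + y| (2 * `|y|); rewrite sum_lt.
  move: (`|x + y|) (`|y|) => a b; clear; lra.
have -> : t *: x + (1 - t) *: y = (1 - t) *: (x + y) + (2 * t - 1) *: x.
  rewrite scalerDr addrAC -scalerDl; congr (_ *: _ + _); ring.
apply: le_lt_trans (ler_normD _ _) _.
rewrite !normZ ?(ltW t'0)//; last by clear -t2; lra.
rewrite xyE.
have := ltr_pM2l t'0 `|x + y| (2 * `|y|); rewrite sum_lt.
move: (`|x + y|) (`|y|) => a b; clear; lra.
Qed.

(** This is weak* lower semicontinuity of the squared norm: it is the supremum of the weak*
    continuous functions [|psi w| ^+ 2] over the unit ball. For negative [a] the vector [0] already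
    works. *)
Lemma dual_norm_sqr_witness (R : realType) (W : normedModType R)
    (phi : dual W) (a : R) : a < `|phi| ^+ 2 -> exists w : W,
  a < `|phi w| ^+ 2 /\ forall psi : dual W, `|psi w| ^+ 2 <= `|psi| ^+ 2.
Proof.
move=> aphi.
have ub (psi : dual W) w : `|w| <= 1 -> `|psi w| ^+ 2 <= `|psi| ^+ 2.
  by move=> w1; rewrite ler_sqr ?nnegrE//; exact: dual_norm_ub.
have [a0|a0] := ltP a 0.
  exists 0; split; first exact: lt_le_trans (sqr_ge0 _).
  by move=> psi; apply: ub; rewrite normr0.
have : Num.sqrt a < dual_norm phi.
  by rewrite -ltr_sqr ?nnegrE ?sqrtr_ge0 ?sqr_sqrtr//; exact: dual_norm_ge0.
move=> /(sup_gt (dual_norm_has_sup phi).1)[_ [w /= w1 <-]] aw.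
exists w; split; last by move=> psi; exact: ub.
by rewrite -[a]sqr_sqrtr// ltr_sqr ?nnegrE ?sqrtr_ge0.
Qed.

Lemma embeds_strictly_convex_function (R : realType) (X : tvsType R)
    (K : set X) (W : normedModType R) :
  strictly_convex_norm (dual W) -> embeds_linearly_weak_star K W ->
  exists f : X -> R, lower_semicontinuous_on K f /\ strictly_convex_on K f.
Proof.
move=> scW [T [linT [contT [g [gK _]]]]].
exists (fun x => `|T x| ^+ 2); split.
  apply/lower_semicontinuous_onP => x a Kx.
  move=> /dual_norm_sqr_witness[w [aw wle]].
  have cw : {for T x : weak_star W,
      continuous (fun phi : weak_star W => `|phi w| ^+ 2)}.
    have /cvg_norm c := @weak_star_eval_continuous R W w (T x).
    suff : {for T x : weak_star W,
        continuous (fun phi : weak_star W => `|phi w| * `|phi w|)} by [].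
    exact: (cvgM c c).
  have : nbhs (T x : weak_star W) [set phi : weak_star W | a < `|phi w| ^+ 2].
    exact: cw (open_nbhs_nbhs (conj (@open_gt R a) aw)).
  move/subspace_continuousP/(_ x Kx): contT => /[apply].
  move=> h; apply: (@filterS _ (nbhs x) _ _ _ _ h) => y /= ay Ky.
  exact: lt_le_trans (ay Ky) (wle _).
move=> x y t Kx Ky xy t01.
rewrite (linear_on_comb linT); try exact: sub_linear_span.
apply: strictly_convex_norm_sqr => // Txy; apply: xy.
by rewrite -(gK x) ?mem_set// Txy gK// mem_set.
Qed.

Lemma embeds_linearly_weak_starW (R : realType) (X : tvsType R)
    (K K' : set X) (W : normedModType R) : K `<=` K' ->
  embeds_linearly_weak_star K' W -> embeds_linearly_weak_star K W.
Proof.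
move=> KK' [T [linT [contT [g [gK contg]]]]]; exists T; split; [|split].
- have KK's : linear_span K `<=` linear_span K'.
    by apply: linear_span_sub => x /KK'; exact: sub_linear_span.
  by move=> a x y Kx Ky; apply: linT; exact: KK's.
- exact: continuous_subspaceW contT.
- exists g; split; first by move=> x /set_mem/KK' Kx; apply: gK; exact: mem_set.
  by apply: continuous_subspaceW contg; exact: image_subset.
Qed.

Theorem theorem1p1 (R : realType) (X : tvsType R) (hX : hausdorff_space X)
    (K : set X) (convK : convex_set (K : set (convex_lmodType X)))
    (compK : compact K) :
  (exists f : X -> R,
     lower_semicontinuous_on K f /\ strictly_convex_on K f) <->
  (exists W : completeNormedModType R,
     strictly_convex_norm (dual W) /\ embeds_linearly_weak_star K W).
Proof.
split=> [[f [/lower_semicontinuous_onP lscf scf]]|[W [scW emb]]]; last first.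
  exact: embeds_strictly_convex_function emb.
have [K0|/set0P K0] := eqVneq K set0; last first.
  have [g [g01 scg lscg]] :=
    unit_strictly_convex_function hX compK (tvs_convexP convK) lscf scf K0.
  exact: body_embedding hX compK (tvs_convexP convK) g01 scg lscg K0.
(* The body is built over a nonempty set, so the empty [K] is embedded as a subset of [[set 0]], on
   which the zero function is vacuously strictly convex. *)
have [||||||W [scW emb]] := @body_embedding R X [set 0] (fun=> 0) hX.
- exact: compact_set1.
- by move=> x y t -> -> _; rewrite !scaler0 addr0.
- by move=> x _; rewrite lexx ler01.
- by move=> x y t -> ->.
- by move=> x a _ a0; exact: nearW.
- by exists 0.
exists W; split => //; apply: embeds_linearly_weak_starW emb.
by rewrite K0.
Qed.
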